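(* Let $\mathcal{X}_n$ denote the set of $n$-variable Boolean functions $f:\{-1,1\}^n\to\{-1,1\}$ that are bent, or satisfy $\mathrm{SAC}(k)$ for some $k\ge0$, or satisfy $\mathrm{PC}(k)$ for some $k\ge1$. Then: (1) for every $n\ge 4$, no $n$-variable monotone Boolean function belongs to $\mathcal{X}_n$; (2) for every $n\ge 16$, no $n$-variable linear threshold function belongs to $\mathcal{X}_n$; (3) for every positive integer $d$ there exists a positive integer $\mathfrak n_0$ (depending on $d$) such that for every $n\ge\mathfrak n_0$, no $n$-variable Boolean function in $\mathrm{AC}^0[d]$ belongs to $\mathcal{X}_n$.
   Context: For $f:\{-1,1\}^n\to\{-1,1\}$ and $S\subseteq[n]$, $\widehat f(S)=2^{-n}\sum_{\mathbf x\in\{-1,1\}^n} f(\mathbf x)\prod_{i\in S}x_i$. $\mathbf x^{\oplus i}$ ($\mathbf x^{\oplus S}$) denotes $\mathbf x$ with coordinate $i$ (all coordinates in $S$) negated. $\mathrm{Inf}_i(f)=\Pr_{\mathbf x}[f(\mathbf x)\ne f(\mathbf x^{\oplus i})]$ and $\mathrm{Inf}_S(f)=\Pr_{\mathbf x}[f(\mathbf x)\ne f(\mathbf x^{\oplus S})]$ for uniform $\mathbf x$. For even $n$, $f$ is bent if $\widehat f(S)=\pm2^{-n/2}$ for all $S\subseteq[n]$. $f$ satisfies SAC if $\mathrm{Inf}_i(f)=1/2$ for all $i$; for $0\le k\le n-2$, $f$ satisfies $\mathrm{SAC}(k)$ if fixing any $k$ variables to arbitrary values in $\{-1,1\}$ yields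 a function satisfying SAC. For $1\le k\le n$, $f$ satisfies $\mathrm{PC}(k)$ if $\mathrm{Inf}_S(f)=1/2$ for all $S$ with $1\le|S|\le k$. $f$ is monotone if $\mathbf a\le\mathbf b$ coordinatewise implies $f(\mathbf a)\le f(\mathbf b)$. $f$ is a linear threshold function if there are reals $w_0,\dots,w_n$ with $f(\mathbf x)=\mathrm{sign}(w_0+w_1x_1+\cdots+w_nx_n)$ for all $\mathbf x$, where $\mathrm{sign}(z)=1$ if $z>0$ and $-1$ if $z\le0$. A depth-$d$ circuit on $n$ variables is a leveled circuit of unbounded fan-in AND and OR gates with inputs $x_1,\dots,x_n,\overline{x}_1,\dots,\overline{x}_n$, with $d$ levels, gates at level $i$ taking inputs only from level $i-1$, all gates on a level of the same type and types alternating between levels; its size is its number of gates. $\mathrm{AC}^0[d]$ is the set of Boolean functions computable by depth-$d$ circuits whose size is bounded by a (fixed) polynomial in $n$. *)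

(* Defs.v *)
From HB Require Import structures.
From mathcomp Require Import all_boot all_order all_algebra.
From mathcomp Require Import reals.

Set Implicit Arguments.
Unset Strict Implicit.
Unset Printing Implicit Defensive.

Import Order.TTheory GRing.Theory Num.Theory.
Local Open Scope ring_scope.

(* {-1,1} is encoded by [bool], with [true] standing for 1 and [false] for -1
   (so that -1 <= 1 is the order of [bool]); [pm] is the value in R.  Cubes are
   indexed by an arbitrary finite type of variables, because the variables of
   a restriction of a function on {-1,1}^n are only a subset of [n]. *)
Definition cube (I : finType) : finType := {ffun I -> bool}.

Definition boolfun (I : finType) : Type := cube I -> bool.

Definition pm (R : realType) (b : bool) : R := if b then 1 else -1.

Definition fourier (R : realType) (n : nat) (f : boolfun 'I_n)
    (S : {set 'I_n}) : R :=
  (2 ^+ n)^-1 * \sum_(x : cube 'I_n) pm R (f x) * \prod_(i in S) pm R (x i).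

Definition flip (I : finType) (x : cube I) (S : {set I}) : cube I :=
  [ffun i => if i \in S then ~~ x i else x i].

Definition influence (R : realType) (I : finType) (f : boolfun I)
    (S : {set I}) : R :=
  #|[set x : cube I | f x != f (flip x S)]|%:R / #|cube I|%:R.

Definition bent (R : realType) (n : nat) (f : boolfun 'I_n) : Prop :=
  ~~ odd n /\
  forall S : {set 'I_n},
    fourier R f S = (2 ^+ n./2)^-1 \/ fourier R f S = - (2 ^+ n./2)^-1.

Definition SAC (R : realType) (I : finType) (f : boolfun I) : Prop :=
  forall i : I, influence R f [set i] = 1 / 2.

(* The variables in [J] are fixed to their values in [z] (the other values of
   [z] are irrelevant); the result is a function of the variables outside [J]. *)
Definition restriction (n : nat) (f : boolfun 'I_n) (J : {set 'I_n})
    (z : cube 'I_n) : boolfun {i : 'I_n | i \notin J} :=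
  fun y => f [ffun i => if insub i is Some j then y j else z i].

Definition SACk (R : realType) (n k : nat) (f : boolfun 'I_n) : Prop :=
  forall (J : {set 'I_n}) (z : cube 'I_n),
    #|J| = k -> SAC R (restriction f (J := J) z).

Definition PC (R : realType) (n k : nat) (f : boolfun 'I_n) : Prop :=
  forall S : {set 'I_n}, (1 <= #|S| <= k)%N -> influence R f S = 1 / 2.

Definition inX (R : realType) (n : nat) (f : boolfun 'I_n) : Prop :=
  [\/ bent R f,
      exists k : nat, (k + 2 <= n)%N /\ SACk R k f
    | exists k : nat, (1 <= k <= n)%N /\ PC R k f].

Definition monotone (n : nat) (f : boolfun 'I_n) : Prop :=
  forall a b : cube 'I_n,
    (forall i : 'I_n, (a i <= b i)%O) -> (f a <= f b)%O.

(* Unlike [Num.sg], this takes the value -1 at 0. *)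
Definition sign (R : realType) (z : R) : R := if 0 < z then 1 else -1.

Definition LTF (R : realType) (n : nat) (f : boolfun 'I_n) : Prop :=
  exists (w0 : R) (w : 'I_n -> R), forall x : cube 'I_n,
    pm R (f x) = sign (w0 + \sum_(i < n) w i * pm R (x i)).

(* [levels n d m]: [d] levels of gates over [n] variables, the last of which has
   [m] nodes.  Level 0 consists of the 2n literals, [lshift n i] being x_i and
   [rshift n i] its negation; a gate is the set of its inputs on the level
   immediately below. *)
Inductive levels (n : nat) : nat -> nat -> Type :=
| Literals : levels n 0 (n + n)
| AddLevel (d m m' : nat) :
    levels n d m -> ('I_m' -> {set 'I_m}) -> levels n d.+1 m'.

Fixpoint num_gates (n d m : nat) (c : levels n d m) : nat :=
  match c with
  | Literals => 0
  | @AddLevel _ _ _ m' c' _ => num_gates c' + m'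
  end.

(* Value of the nodes of the last level, which are AND gates if [is_and] and OR
   gates otherwise; the types of the levels below are then forced, as they
   alternate.  The truth value true is encoded by 1. *)
Fixpoint node_value (n d m : nat) (is_and : bool) (c : levels n d m)
    (x : cube 'I_n) : 'I_m -> bool :=
  match c in levels _ d' m' return 'I_m' -> bool with
  | Literals => fun j =>
      match split j with inl i => x i | inr i => ~~ x i end
  | AddLevel _ _ _ c' g => fun j =>
      if is_and then [forall i in g j, node_value (~~ is_and) c' x i]
      else [exists i in g j, node_value (~~ is_and) c' x i]
  end.

(* Computability by a depth-[d] circuit of size at most p(n).  The polynomial
   is a parameter: it has to be chosen before [n], as for a given [n] every
   function has a circuit of size bounded by some polynomial.  The circuit's
   output is a designated gate of its last level. *)
Definition AC0 (R : realType) (p : {poly R}) (d n : nat) (f : boolfun 'I_n) :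
    Prop :=
  exists (m : nat) (c : levels n d m) (is_and : bool) (out : 'I_m),
    (num_gates c)%:R <= p.[n%:R] /\
    forall x : cube 'I_n, f x = node_value is_and c x out.

(* Main.v *)
(* Each of the three conditions defining X_n implies SAC: for bent functions by
   Parseval applied to the derivative of f, for SAC(k) by averaging over the fixed
   variables.  Under SAC a unate function (monotone functions and threshold
   functions are unate) has all its degree-1 Fourier coefficients equal to +-1/2,
   which contradicts Parseval for n >= 4.
   For circuits, SAC makes the total influence n/2, whereas depth-d circuits of
   polynomial size have total influence O(n^(1/2)).  Indeed, a random restriction
   with star probability 2^-m scales the expected total influence by exactly 2^-m,
   and by a switching lemma in the style of Furst, Saxe and Sipser it turns an OR
   of arbitrarily many O(1)-juntas into an O(1)-junta, except with probability
   2^(-K m) for any prescribed constant K.  Collapsing the d levels one after the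
   other bounds the total influence by O(2^(d m)); take 2^m about n^(1/(2d)). *)
Require Import Defs.
From HB Require Import structures.
From mathcomp Require Import all_boot all_order all_algebra.
From mathcomp Require Import reals zify ring lra.

Set Implicit Arguments.
Unset Strict Implicit.
Unset Printing Implicit Defensive.

(** * Sensitivity, juntas and random restrictions *)

Definition sens (I : finType) (f : boolfun I) (i : I) : {set cube I} :=
  [set x | f x != f (flip x [set i])].

Definition depends_on (I : finType) (f : boolfun I) (V : {set I}) : Prop :=
  forall x y : cube I, {in V, x =1 y} -> f x = f y.

Definition junta (I : finType) (b : nat) (f : boolfun I) : Prop :=
  exists2 V : {set I}, #|V| <= b & depends_on f V.

(* A random restriction: a coordinate [(v, l)] leaves its variable free if
   [l = 0], which has probability [2^-m], and otherwise fixes it to [v]. *)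
Definition restrictions (I : finType) (m : nat) : finType :=
  {ffun I -> bool * 'I_(2 ^ m)}.

Definition star (m : nat) (t : bool * 'I_(2 ^ m)) : bool := t.2 == 0 :> nat.

Definition restr (I : finType) (m : nat) (w : restrictions I m) (y : cube I) :
    cube I :=
  [ffun i => if star (w i) then y i else (w i).1].

(** * Counting and independence in finite product spaces *)

(** Probabilities are handled in [nat], cleared of denominators: for uniform [w] the events
    [w i \in P i] are independent. *)
Lemma card_cylinder (I T : finType) (S : {set I}) (P : I -> {set T}) :
  #|[set w : {ffun I -> T} | [forall i in S, w i \in P i]]| * #|T| ^ #|S| =
  \prod_(i in S) #|P i| * #|{ffun I -> T}|.
Proof.
pose F i := [pred t | (i \in S) ==> (t \in P i)].
transitivity (#|family F| * #|T| ^ #|S|).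
  congr (_ * _); apply: eq_card => w; rewrite inE.
  apply/forall_inP/familyP => h i; first by apply/implyP => /h.
  by move=> iS; have /implyP := h i; apply.
rewrite card_family foldrE big_map big_enum /= (bigID (mem S)) /=.
rewrite card_ffun -(cardC (mem S)) expnD -mulnA; congr (_ * _).
  by apply: eq_bigr => i iS; apply: eq_card => t; rewrite unfold_in /= iS.
rewrite mulnC; congr (_ * _).
rewrite (eq_bigr (fun=> #|T|)) ?prod_nat_const; last first.
  by move=> i /negbTE iS; apply: eq_card => t; rewrite unfold_in /= iS.
by congr (_ ^ _); apply: eq_card => i; rewrite unfold_in.
Qed.

(** Exchanging the coordinates outside [U] between two points is an involution on pairs, which
    carries [A] times [B] to [A :&: B] times the whole space. *)
Lemma card_indep (I T : finType) (U : {set I}) (A B : {set {ffun I -> T}}) :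
  (forall w w' : {ffun I -> T}, {in U, w =1 w'} -> w \in A -> w' \in A) ->
  (forall w w' : {ffun I -> T}, {in ~: U, w =1 w'} -> w \in B -> w' \in B) ->
  #|A :&: B| * #|{ffun I -> T}| = #|A| * #|B|.
Proof.
move=> dA dB.
pose mix (w w' : {ffun I -> T}) : {ffun I -> T} :=
  [ffun i => if i \in U then w i else w' i].
pose swap (p : {ffun I -> T} * {ffun I -> T}) := (mix p.1 p.2, mix p.2 p.1).
have swapK : involutive swap.
  case=> w w'; rewrite /swap /=.
  by congr (_, _); apply/ffunP => i; rewrite !ffunE; case: (i \in U).
rewrite -!cardsX -cardsT -cardsX.
rewrite -(card_preimset _ (inv_inj swapK)).
apply: eq_card => -[w w']; rewrite !inE /= andbT.
have mixl (a b : {ffun I -> T}) : {in U, a =1 mix a b} by move=> i iU; rewrite ffunE iU.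
have mixr (a b : {ffun I -> T}) : {in ~: U, b =1 mix a b}.
  by move=> i; rewrite inE ffunE => /negbTE ->.
congr (_ && _); apply/idP/idP.
- by apply: dA => i iU; rewrite -mixl.
- by apply: dA; apply: mixl.
- by apply: dB => i iU; rewrite -mixr.
- by apply: dB; apply: mixr.
Qed.


Lemma card_pairs (T T' : finType) (D : {set T * T'}) :
  #|D| = \sum_(w : T) #|[set y | (w, y) \in D]|.
Proof.
rewrite -sum1_card.
rewrite (eq_bigl (fun p => xpredT p.1 && ((p.1, p.2) \in D))); last by case.
rewrite -(pair_big_dep xpredT (fun w y => (w, y) \in D) (fun _ _ => 1)) /=.
by apply: eq_bigr => w _; rewrite sum1dep_card.
Qed.

(** With [N] the size of the sample space, [1 / X] bounds each probability; [X = 1] just bounds the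
    size of a union. *)
Lemma union_bound (T J : finType) (P : {set J}) (B : J -> {set T}) (X N : nat) :
  (forall j, j \in P -> #|B j| * X <= N) ->
  #|\bigcup_(j in P) B j| * X <= #|P| * N.
Proof.
move=> hB; apply: (@leq_trans (\sum_(j in P) #|B j| * X)); last first.
  by rewrite -sum_nat_const; apply: leq_sum.
rewrite -big_distrl leq_mul2r /=; apply/orP; right.
elim/big_ind2: _ => [|A a C c hA hC|//]; first by rewrite cards0.
by apply: leq_trans (leq_card_setU _ _) _; apply: leq_add.
Qed.

(** * Free and fixed variables of a random restriction *)

Lemma card_star (m : nat) : #|[set t | star (m := m) t]| = 2.
Proof.
have h0 : 0 < 2 ^ m by rewrite expn_gt0.
rewrite -[RHS]muln1 -[in RHS]card_bool -[X in _ * X](cards1 (Ordinal h0)).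
rewrite -cardsT -cardsX.
by apply: eq_card => -[v l]; rewrite !inE.
Qed.

Lemma card_all_star (I : finType) (m : nat) (S : {set I}) :
  #|[set w : restrictions I m | [forall i in S, star (w i)]]| * (2 ^ m) ^ #|S| =
  #|restrictions I m|.
Proof.
have := @card_cylinder I _ S (fun=> [set t | star (m := m) t]).
rewrite card_star prod_nat_const card_prod card_bool card_ord expnMn.
have -> : [set w : {ffun I -> bool * 'I_(2 ^ m)} |
      [forall i in S, w i \in [set t | star (m := m) t]]] =
    [set w : restrictions I m | [forall i in S, star (w i)]].
  by apply/setP=> w; rewrite !inE; apply: eq_forallb => i; rewrite !inE.
by move=> /eqP; rewrite mulnCA eqn_pmul2l ?expn_gt0 // => /eqP.
Qed.

(** Such a [w] makes every function that depends only on [S] constant, with its value at [x]. *)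
Definition forced (I : finType) (m : nat) (S : {set I}) (x : cube I)
    (w : restrictions I m) : bool :=
  [forall i in S, ~~ star (w i) && ((w i).1 == x i)].

(** As [0 < m], a variable is free with probability at most 1/2; both fixed values are equally
    likely, so each has probability at least 1/4. *)
Lemma card_forced (I : finType) (m : nat) (S : {set I}) (x : cube I) :
  0 < m ->
  #|restrictions I m| <=
  #|[set w : restrictions I m | forced S x w]| * 4 ^ #|S|.
Proof.
move=> m0; set E := [set w | _].
pose P i := [set t : bool * 'I_(2 ^ m) | ~~ star t && (t.1 == x i)].
have cP i : #|bool : finType| * 2 ^ m <= #|P i| * 4.
  have := cardsC [set t | star (m := m) t].
  pose Q := [set t : bool * 'I_(2 ^ m) | ~~ star t && (t.1 == ~~ x i)].
  have -> : ~: [set t | star (m := m) t] = P i :|: Q.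
    by apply/setP=> -[v l]; rewrite !inE /=; case: (star (v, l)); case: v; case: (x i).
  rewrite card_star card_prod card_bool card_ord => h1.
  have h2 : #|Q| <= #|P i|.
    pose neg (t : bool * 'I_(2 ^ m)) := (~~ t.1, t.2).
    rewrite -(card_preimset (P i) (_ : injective neg)).
      apply/subset_leq_card/subsetP=> -[v l]; rewrite !inE /star /=.
      by case: (l == 0 :> nat); case: v; case: (x i).
    by case=> [v l] [v' l'] [/negb_inj -> ->].
  have h3 := (leq_card_setU (P i) Q).1.
  have h4 : 2 <= 2 ^ m by rewrite -{1}[2]expn1 leq_exp2l.
  have := leq_trans h3 (leq_add (leqnn _) h2).
  rewrite -(leq_add2l 2) h1 addnn -muln2 => h5.
  rewrite -(leq_add2l 4) (_ : _ + _ * 4 = (2 + #|P i| * 2) * 2); last by lia.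
  by apply: leq_trans (leq_mul h5 (leqnn 2)); lia.
have := @card_cylinder I _ S P.
have -> : [set w : {ffun I -> bool * 'I_(2 ^ m)} | [forall i in S, w i \in P i]] = E.
  by apply/setP=> w; rewrite !inE; apply: eq_forallb => i; rewrite !inE.
rewrite card_prod card_ord => h.
have h4 : (#|{: bool}| * 2 ^ m) ^ #|S| <= (\prod_(i in S) #|P i|) * 4 ^ #|S|.
  rewrite -!prod_nat_const -big_split /=.
  by apply: leq_prod => i _; apply: cP.
have h5 : 0 < (#|{: bool}| * 2 ^ m) ^ #|S| by rewrite card_bool expn_gt0 muln_gt0 expn_gt0.
rewrite -(leq_pmul2l h5) [leqRHS]mulnA [_ ^ _ * #|E|]mulnC h mulnAC.
by rewrite leq_mul2r h4 orbT.
Qed.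

(** A uniform point of a random restriction is uniform in the whole cube, and flipping [i] moves it
    only if [i] is free, which has probability 2^-m. *)
Lemma sum_card_sens_restr (I : finType) (m : nat) (f : boolfun I) (i : I) :
  2 ^ m * (\sum_(w : restrictions I m) #|sens (fun y => f (restr w y)) i|) =
  #|restrictions I m| * #|sens f i|.
Proof.
pose A := [set w : restrictions I m | [forall k in [set i], star (w k)]].
rewrite -(card_all_star m [set i]) -/A cards1 expn1 mulnC mulnAC; congr (_ * _).
(* Exchanging the fixed values of [w] with the irrelevant coordinates of [y] turns
   [restr w y] into a uniform point that is independent of the stars. *)
pose swap (p : restrictions I m * cube I) : restrictions I m * cube I :=
  ([ffun k => if star (p.1 k) then p.1 k else (p.2 k, (p.1 k).2)],
   restr p.1 p.2).
have swapK : involutive swap.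
  case=> w y; rewrite /swap /=; congr (_, _); apply/ffunP => k;
    rewrite /restr /star !ffunE /=;
    have [hs|/negbTE hs] := boolP ((w k).2 == 0 :> nat);
    by rewrite ?hs /= ?hs //; case: (w k).
rewrite -cardsX -(card_preimset _ (inv_inj swapK)) card_pairs.
apply: eq_bigr => w _; apply: eq_card => y.
rewrite !inE /=.
have -> : [forall k in [set i],
    star ([ffun k0 => if star (w k0) then w k0 else (y k0, (w k0).2)] k)] =
    star (w i).
  apply/forall_inP/idP => [/(_ i)|h k]; last by rewrite inE => /eqP ->; rewrite ffunE h.
  by rewrite inE ffunE /star => /(_ (eqxx _)); case: ifP => //= ->.
have [hs|hs] := boolP (star (w i)).
  congr (_ != f _); apply/ffunP => k; rewrite !ffunE inE.
  by case: (k =P i) => [->|_]; rewrite ?hs.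
have -> : restr w (flip y [set i]) = restr w y; last by rewrite eqxx.
apply/ffunP => k; rewrite !ffunE inE; case: ifP => // hk.
by case: (k =P i) => // e; rewrite -e hk in hs.
Qed.

(** Disjoint supports make the events independent, and each has probability at most 1 - 4^-c. *)
Lemma card_none_forced (I J : finType) (m c : nat) (V : J -> {set I})
    (x : J -> cube I) (s : seq J) :
  0 < m -> all (fun j => #|V j| <= c) s ->
  pairwise (fun i j => [disjoint V i & V j]) s ->
  #|[set w : restrictions I m | all (fun j =>
      ~~ forced (V j) (x j) w) s]|
    * (4 ^ c) ^ size s <=
  (4 ^ c).-1 ^ size s * #|restrictions I m|.
Proof.
move=> m0; have forced_local j (w w' : restrictions I m) :
    {in V j, w =1 w'} -> forced (V j) (x j) w = forced (V j) (x j) w'.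
  move=> e; apply: eq_forallb => i.
  by have [iV|//] := boolP (i \in V j); rewrite /= e.
elim: s => [|j s IH] /=; first by rewrite !expn0 muln1 mul1n max_card.
move=> /andP[cj cs] /andP[dj ds].
pose A := [set w : restrictions I m | ~~ forced (V j) (x j) w].
pose B := [set w : restrictions I m | all (fun k => ~~ forced (V k) (x k) w) s].
have -> : [set w : restrictions I m | ~~ forced (V j) (x j) w &
    all (fun j => ~~ forced (V j) (x j) w) s] = A :&: B.
  by apply/setP=> w; rewrite !inE.
have hA : #|A| * 4 ^ c <= (4 ^ c).-1 * #|restrictions I m|.
  have := card_forced (V j) (x j) m0 => hf.
  have := cardsC [set w : restrictions I m | forced (V j) (x j) w].
  have -> : ~: [set w : restrictions I m | forced (V j) (x j) w] = A.
    by apply/setP=> w; rewrite !inE.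
  have h4 : 4 ^ #|V j| <= 4 ^ c by rewrite leq_exp2l.
  have := leq_trans hf (leq_mul (leqnn _) h4).
  have : 0 < 4 ^ c by rewrite expn_gt0.
  case: (4 ^ c) => // q _ /=.
  move: #|A| #|[set w : restrictions I m | _]| #|restrictions I m|.
  move=> a e n /[swap] <-.
  rewrite !mulnS mulnDr; nia.
have hB := IH cs ds.
have indep : #|A :&: B| * #|restrictions I m| = #|A| * #|B|.
  apply: (@card_indep _ _ (V j)) => w w' e.
    by rewrite !inE (forced_local j w w' e).
  rewrite !inE => /allP h; apply/allP => k ks.
  rewrite -(forced_local k w w'); first exact: h.
  move=> i ik; apply: e.
  rewrite inE; apply/negP => ij.
  have /allP/(_ k ks) := dj.
  by move=> /pred0P/(_ i) /=; rewrite ij ik.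
have n0 : 0 < #|restrictions I m|.
  by rewrite card_ffun card_prod card_bool card_ord !(expn_gt0, muln_gt0).
rewrite -(leq_pmul2r n0) !expnS mulnAC indep.
have := leq_mul hA hB.
by rewrite mulnACA [leqRHS]mulnACA !mulnA.
Qed.

(** * A switching lemma, applied to the levels of a circuit *)

(** Greedy choice: once no support is disjoint from the union of those chosen, that union is the
    hitting set. *)
Lemma disjoint_or_hitting (I J : finType) (S : {set J}) (V : J -> {set I})
    (c D : nat) :
  (forall j, j \in S -> #|V j| <= c) ->
  (exists s : seq J, [/\ size s = D, {subset s <= S} &
     pairwise (fun i j => [disjoint V i & V j]) s]) \/
  (exists2 U : {set I}, #|U| <= c * D &
     forall j, j \in S -> ~~ [disjoint V j & U]).
Proof.
move=> hc; elim: D => [|D [[s [sz sS ds]]|[U cU hU]]]; first by left; exists [::].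
  pose U := \bigcup_(j in [set j in s]) V j.
  have cU : #|U| <= c * D.
    have := union_bound (P := [set j in s]) (B := V) (X := 1) (N := c).
    rewrite muln1 => /(_ _)/leq_trans; apply.
      by move=> k; rewrite inE muln1 => /sS/hc.
    rewrite mulnC leq_mul2l -sz.
    by rewrite cardsE card_size orbT.
  have [/exists_inP[j jS dj]|] := boolP [exists j in S, [disjoint V j & U]].
    left; exists (j :: s); split=> /=; first by rewrite sz.
      by move=> k; rewrite inE => /orP[/eqP ->|/sS].
    rewrite ds andbT; apply/allP => k ks; apply: disjointWr dj.
    by apply: (bigcup_sup k); rewrite inE.
  rewrite negb_exists_in => /forall_inP h; right; exists U => //.
  by apply: leq_trans cU _; rewrite leq_mul2l leqnSn orbT.
by right; exists U => //; apply: leq_trans cU _; rewrite leq_mul2l leqnSn orbT.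
Qed.

(** This is (1 - 1/q)^q <= 1/2 raised to the power [k]; [h] keeps the first two terms of a binomial
    expansion. *)
Lemma leq_exp_pred (q k : nat) : 0 < q -> 2 ^ k * q.-1 ^ (q * k) <= q ^ (q * k).
Proof.
case: q k => // q [|k] _ /=; first by rewrite muln0.
rewrite !expnM -expnMn leq_exp2r //.
have h : forall r, q ^ r.+1 + r.+1 * q ^ r <= q.+1 ^ r.+1.
  elim=> [|r IH]; first by rewrite !expn0 !expn1; lia.
  rewrite [leqRHS]expnS; apply: leq_trans (leq_mul (leqnn _) IH).
  rewrite !expnS; move: (q ^ r) => Q; nia.
by apply: leq_trans (h q); rewrite mul2n -addnn leq_add2l expnS leq_mul2r leqnSn orbT.
Qed.

(* Induction on the width [c].  If many of the juntas have disjoint supports, some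
   junta is forced to 1 with high probability.  Otherwise all supports meet a set
   [U] of size O(m); fixing the variables in [U] decreases the width, and the
   2^|U| = 2^(O(m)) ways of doing so are absorbed by a union bound, at the price of
   a larger exponent [r] in the induction hypothesis.  The same crude bound shows
   that at most [r] variables of [U] stay free. *)
Lemma switching (c K : nat) :
  exists b, forall (m : nat) (I J : finType) (S : {set J}) (g : J -> boolfun I)
      (V : J -> {set I}),
    0 < m ->
    (forall j, j \in S -> #|V j| <= c /\ depends_on (g j) (V j)) ->
    exists2 Bad : {set restrictions I m},
      #|Bad| * (2 ^ m) ^ K <= #|restrictions I m| &
      forall w, w \notin Bad ->
        junta b (fun y => [exists j in S, g j (restr w y)]).
Proof.
elim: c K => [|c IH] K.
  exists 0 => m I J S g V m0 hS; exists set0; first by rewrite cards0.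
  move=> w _; exists set0; rewrite ?cards0 // => y y' _.
  apply: eq_existsb => j; have [jS|//] := boolP (j \in S).
  have [cV dV] := hS j jS; apply: dV => i.
  by move: cV; rewrite leqn0 cards_eq0 => /eqP ->; rewrite inE.
(* [A * m] will bound [#|U|]. In [r], the exponent [A] pays for the union bounds over subsets of
   [U], [1] for adding two bad events, and [K] remains. *)
pose A := c.+1 * (4 ^ c.+1 * K).
pose r := A + 1 + K.
have [b hb] := IH r.
(* At most [r] free variables of [U], and a support of size [b] for each assignment to them. *)
exists (r + 2 ^ r * b) => m I J S g V m0 hS.
(* The default occurs only if [g j] is identically false; [S'] discards such [j]. *)
pose x j : cube I := if [pick x | g j x] is Some x then x else [ffun=> true].
pose S' := [set j in S | g j (x j)].
have SE y : [exists j in S, g j y] = [exists j in S', g j y].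
  apply: eq_existsb => j; rewrite inE; case: (j \in S) => //=.
  rewrite /x; case: pickP => [z ->//|->]; exact/esym/andbF.
have S'S j : j \in S' -> j \in S by rewrite inE => /andP[].
(* This many disjoint supports bring the probability that none is forced down to 2^(-K m). *)
have [j /S'S/hS[]//|[s [sz sS ds]]|[U cU hU]] :=
    @disjoint_or_hitting _ _ S' V c.+1 (4 ^ c.+1 * (K * m)).
- exists [set w : restrictions I m | all (fun j => ~~ forced (V j) (x j) w) s].
    have cs : all (fun j => #|V j| <= c.+1) s by apply/allP => j /sS/S'S/hS[].
    have := card_none_forced x m0 cs ds; rewrite sz => h1.
    have q0 : 0 < 4 ^ c.+1 by rewrite expn_gt0.
    have h2 := leq_exp_pred (K * m) q0.
    rewrite -expnM [m * K]mulnC.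
    rewrite -(leq_pmul2r (_ : 0 < (4 ^ c.+1) ^ (4 ^ c.+1 * (K * m)))).
      rewrite mulnAC; apply: leq_trans (leq_mul h1 (leqnn _)) _.
      by rewrite mulnAC mulnC leq_mul2l [_ * 2 ^ _]mulnC h2 orbT.
    by rewrite expn_gt0 q0.
  move=> w; rewrite inE => /allPn[j js /negPn fj].
  exists set0; rewrite ?cards0 // => y y' _.
  suff h z : [exists j in S, g j (restr w z)] by rewrite !h.
  apply/exists_inP; exists j; first exact/S'S/sS.
  have := sS j js; rewrite inE => /andP[jS gx].
  have [_ dV] := hS j jS; rewrite (dV _ (x j)) // => i iV; rewrite ffunE.
  by have /forall_inP/(_ i iV)/andP[/negbTE -> /eqP ->] := fj.
(* The values on [U] are overridden after the restriction by a [Z] independent of [w], so the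
   induction hypothesis applies on the same sample space. *)
pose plug (Z : {set I}) (y : cube I) : cube I :=
  [ffun i => if i \in U then i \in Z else y i].
have hZ Z : exists2 Bad : {set restrictions I m},
      #|Bad| * (2 ^ m) ^ r <= #|restrictions I m| &
      forall w, w \notin Bad ->
        junta b (fun y => [exists j in S', g j (plug Z (restr w y))]).
  apply: (hb m I J S' (fun j y => g j (plug Z y)) (fun j => V j :\: U) m0) => j jS.
  have [cV dV] := hS j (S'S j jS); split.
    rewrite cardsD; have : 0 < #|V j :&: U| by rewrite card_gt0 setI_eq0 hU.
    by lia.
  move=> y y' e; apply: dV => i iV; rewrite !ffunE; case: ifP => // iU.
  by apply: e; rewrite inE iU.
have [BadZ cBad hBad] := fin_all_exists2 hZ.
pose P := [set W in powerset U | #|W| == r].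
(* [Bad1]: some [r] variables of [U] all stay free. [Bad2]: the induction hypothesis fails for some
   assignment to [U]. *)
pose Bad1 := \bigcup_(W in P) [set w : restrictions I m | [forall i in W, star (w i)]].
pose Bad2 := \bigcup_(Z in powerset U) BadZ Z.
exists (Bad1 :|: Bad2).
  have m2 : 2 <= 2 ^ m by rewrite -{1}[2]expn1 leq_exp2l.
  have cP : #|powerset U| <= (2 ^ m) ^ A.
    by rewrite card_powerset -expnM leq_exp2l // (leq_trans cU) // /A; lia.
  have h1 : #|Bad1| * (2 ^ m) ^ r <= (2 ^ m) ^ A * #|restrictions I m|.
    apply: leq_trans (union_bound (N := #|restrictions I m|) _) _.
      by move=> W; rewrite inE => /andP[_ /eqP <-]; rewrite card_all_star.
    rewrite leq_mul2r; apply/orP; right; apply: leq_trans cP.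
    by apply/subset_leq_card/subsetP => W; rewrite inE => /andP[].
  have h2 : #|Bad2| * (2 ^ m) ^ r <= (2 ^ m) ^ A * #|restrictions I m|.
    apply: leq_trans (union_bound (N := #|restrictions I m|) _) _ => //.
    by rewrite leq_mul2r cP orbT.
  rewrite -(leq_pmul2l (_ : 0 < (2 ^ m) ^ (A + 1))); last by rewrite !expn_gt0.
  rewrite mulnCA -expnD -/r.
  apply: leq_trans (leq_mul (leq_card_setU _ _) (leqnn _)) _.
  rewrite mulnDl; apply: leq_trans (leq_add h1 h2) _.
  rewrite addnn -muln2 expnD expn1 mulnAC leq_mul2r leq_mul2l.
  by rewrite m2 !orbT.
move=> w; rewrite inE negb_or => /andP[w1 w2].
pose F := [set i in U | star (w i)].
have cF : #|F| <= r.
  rewrite leqNgt; apply/negP => /ltnW /card_geqP[s [us ss sF]].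
  move/negP: w1; apply; apply/bigcupP; exists [set i in s].
    rewrite !inE; apply/andP; split.
      by apply/subsetP=> i; rewrite inE => /sF; rewrite inE => /andP[].
    by rewrite cardsE (card_uniqP us) ss.
  by rewrite inE; apply/forall_inP => i; rewrite inE => /sF; rewrite inE => /andP[].
(* The assignment to [U] produced by [w] when its free variables there are set according to [X]. *)
pose Zof (X : {set I}) := [set i in U | if star (w i) then i \in X else (w i).1].
have hW X : exists2 W : {set I}, #|W| <= b &
    depends_on (fun y => [exists j in S', g j (plug (Zof X) (restr w y))]) W.
  apply: hBad; apply/negP => h; move/negP: w2; apply.
  apply/bigcupP; exists (Zof X) => //.
  by rewrite inE; apply/subsetP => i; rewrite inE => /andP[].
have [W cW dW] := fin_all_exists2 hW.
exists (F :|: \bigcup_(X in powerset F) W X).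
  apply: leq_trans (leq_card_setU _ _) _; apply: leq_add => //.
  have := @union_bound _ _ (powerset F) W 1 b.
  rewrite muln1 => /(_ _)/leq_trans; apply; first by move=> X _; rewrite muln1.
  by rewrite card_powerset leq_mul2r leq_exp2l // cF orbT.
move=> y y' e; rewrite !SE.
pose X := [set i in F | y i].
have plugE (z : cube I) : {in F, z =1 y} -> plug (Zof X) (restr w z) = restr w z.
  move=> ez; apply/ffunP => i; rewrite !ffunE !inE.
  have [iU|//] := boolP (i \in U); have [si|//] := boolP (star (w i)).
  by rewrite /= ez // inE iU si.
have := dW X y y'; rewrite !plugE //; last first.
  by move=> i iF; rewrite e // inE iF.
apply => i iW; apply: e; rewrite inE; apply/orP; right.
apply/bigcupP; exists X => //.
by rewrite inE; apply/subsetP => k; rewrite inE => /andP[].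
Qed.

(* Negating both a gate and its inputs ([neg]) turns OR into AND; the bound [s]
   on the number of gates of a level does not apply to the bottom juntas. *)
Fixpoint layered (I : finType) (s b t : nat) (J : finType)
    (F : J -> boolfun I) : Prop :=
  if t is t'.+1 then
    #|J| <= s /\ exists (J' : finType) (G : J' -> boolfun I),
      layered s b t' G /\ forall j, exists (neg : bool) (S : {set J'}),
        forall x, F j x = neg (+) [exists i in S, neg (+) G i x]
  else forall j, junta b (F j).

(** Only the gates directly above the juntas are switched, at most [s] of them; the levels above
    keep their shape. *)
Lemma layered_switching (b K : nat) :
  exists b', forall (m : nat) (I : finType) (s t : nat) (J : finType)
      (F : J -> boolfun I),
    0 < m -> layered s b t.+1 F ->
    exists2 Bad : {set restrictions I m},
      #|Bad| * (2 ^ m) ^ K <= s * #|restrictions I m| &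
      forall w, w \notin Bad -> layered s b' t (fun j y => F j (restr w y)).
Proof.
have [b' hb'] := switching b K.
exists b' => m I s t J F m0; elim: t J F => [|t IH] J F [Js [J' [G [hG hF]]]].
  have [V cV dV] := fin_all_exists2 hG.
  have hj j : exists2 Bad : {set restrictions I m},
      #|Bad| * (2 ^ m) ^ K <= #|restrictions I m| &
      forall w, w \notin Bad -> junta b' (fun y => F j (restr w y)).
    have [neg [S hS]] := hF j.
    have [|Bad cB hB] := hb' m I J' S (fun i y => neg (+) G i y) V m0.
      by move=> i _; split=> // y y' e; rewrite (dV i y y').
    exists Bad => // w /hB[W cW dW]; exists W => // y y' e.
    by rewrite !hS (dW y y').
  have [Bad cB hB] := fin_all_exists2 hj.
  exists (\bigcup_(j in [set: J]) Bad j).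
    by apply: leq_trans (union_bound (N := #|restrictions I m|) _) _;
      rewrite ?cardsT ?leq_mul2r ?Js ?orbT.
  move=> w wB j; apply: hB; apply: contra wB => h; apply/bigcupP.
  by exists j.
have [Bad cB hB] := IH J' G hG.
exists Bad => // w /hB hw; split=> //.
exists J', (fun i y => G i (restr w y)); split=> // j.
by have [neg [S hS]] := hF j; exists neg, S => y; rewrite hS.
Qed.

(** Literals are juntas of size 1; by De Morgan an AND gate is the case [neg = true]. *)
Lemma layered_circuit (n d k : nat) (c : levels n d k) (is_and : bool) (s : nat) :
  num_gates c <= s ->
  layered s 1 d (fun (j : 'I_k) (x : cube 'I_n) => node_value is_and c x j).
Proof.
elim: c is_and => [|d' k' k'' c IH g] is_and /=.
  move=> _ j; case: (split j) => i; exists [set i]; rewrite ?cards1 // => x y e;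
    by rewrite e ?inE.
move=> cs; split; first by rewrite card_ord; lia.
exists 'I_k', (fun i x => node_value (~~ is_and) c x i); split.
  by apply: IH; lia.
move=> j; exists is_and, (g j) => x; case: is_and => //=.
by rewrite negb_exists_in; apply: eq_forallb => i; rewrite negbK.
Qed.

(** * Total influence of layered families *)

(** The total influence, multiplied by the size of the cube. *)
Definition total_sens (I : finType) (f : boolfun I) : nat :=
  \sum_(i : I) #|sens f i|.

Lemma junta_total_sens (I : finType) (b : nat) (f : boolfun I) :
  junta b f -> total_sens f <= b * #|cube I|.
Proof.
case=> V cV dV; rewrite /total_sens (bigID (mem V)) /= addnC big1 ?add0n.
  rewrite (leq_trans (_ : _ <= \sum_(i in V) #|cube I|)) //.
    by apply: leq_sum => i _; apply: max_card.
  by rewrite sum_nat_const leq_mul2r cV orbT.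
move=> i iV; apply: eq_card0 => x; rewrite !inE; apply/negbTE/negPn/eqP.
apply: dV => k kV; rewrite ffunE inE; case: eqP => // e.
by rewrite -e kV in iV.
Qed.

Lemma sum_total_sens_restr (I : finType) (m : nat) (f : boolfun I) :
  2 ^ m * (\sum_(w : restrictions I m) total_sens (fun y => f (restr w y))) =
  #|restrictions I m| * total_sens f.
Proof.
rewrite exchange_big !big_distrr; apply: eq_bigr => i _ /=.
exact: sum_card_sens_restr.
Qed.

Lemma layered_total_sens (t b K : nat) :
  exists C, forall (m : nat) (I : finType) (s : nat) (J : finType)
      (F : J -> boolfun I) (j : J),
    0 < m -> #|I| <= (2 ^ m) ^ K -> s <= (2 ^ m) ^ K -> layered s b t F ->
    total_sens (F j) <= C * (2 ^ m) ^ t * #|cube I|.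
Proof.
elim: t b => [|t IH] b.
  exists b => m I s J F j _ _ _ hF; rewrite muln1.
  exact: junta_total_sens.
(* One factor (2^m)^K absorbs the [s] gates, the other the trivial bound [#|I|] on the total
   influence under bad restrictions. *)
have [b' hb'] := layered_switching b (K + K).
have [C hC] := IH b'.
exists C.+1 => m I s J F j m0 hI hs hF.
have [Bad cB hB] := hb' m I s t J F m0 hF.
set M := 2 ^ m in cB hI hs hC *.
have M0 : 0 < M by rewrite expn_gt0.
set N := #|restrictions I m|.
have n0 : 0 < N.
  by rewrite /N card_ffun card_prod card_bool card_ord !(expn_gt0, muln_gt0).
have cBI : #|Bad| * #|I| <= N.
  have h1 : #|Bad| * M ^ K <= N.
    rewrite -(leq_pmul2r (_ : 0 < M ^ K)) ?expn_gt0 ?M0 // -mulnA -expnD.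
    by apply: leq_trans cB _; rewrite mulnC leq_mul2l hs orbT.
  by apply: leq_trans h1; rewrite leq_mul2l hI orbT.
rewrite -(leq_pmul2l n0) -sum_total_sens_restr -/M.
rewrite (bigID (mem Bad)) /=.
have h1 : \sum_(w in Bad) total_sens (fun y => F j (restr w y)) <=
    N * #|cube I|.
  apply: leq_trans (_ : \sum_(w in Bad) #|I| * #|cube I| <= _).
    apply: leq_sum => w _; rewrite -sum_nat_const.
    by apply: leq_sum => i _; apply: max_card.
  by rewrite sum_nat_const mulnA leq_mul2r cBI orbT.
have h2 : \sum_(w | w \notin Bad) total_sens (fun y => F j (restr w y)) <=
    N * (C * M ^ t * #|cube I|).
  apply: leq_trans (_ : \sum_(w : restrictions I m) C * M ^ t * #|cube I| <= _).
    rewrite [leqRHS](bigID (mem Bad)) /=; apply: leq_trans (leq_addl _ _).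
    apply: leq_sum => w wB.
    exact: (hC m I s J (fun j y => F j (restr w y))) (hB w wB).
  by rewrite sum_nat_const.
apply: leq_trans (leq_mul (leqnn M) (leq_add h1 h2)) _.
have h3 : 0 < M ^ t by rewrite expn_gt0 M0.
rewrite -mulnDr mulnCA leq_mul2l; apply/orP; right.
rewrite -[X in X + _]mul1n -mulnDl mulnA leq_mul2r; apply/orP; right.
by rewrite expnS mulnCA leq_mul2l mulSn leq_add2r h3 orbT.
Qed.

(** * Bent, SAC(k) and PC(k) functions satisfy SAC *)

Import Order.TTheory GRing.Theory Num.Theory.
Local Open Scope ring_scope.

Lemma flipK (I : finType) (S : {set I}) : involutive (fun x : cube I => flip x S).
Proof.
by move=> x; apply/ffunP => i; rewrite !ffunE; case: (i \in S); rewrite ?negbK.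
Qed.

Lemma pm_neg (R : realType) (b : bool) : pm R (~~ b) = - pm R b.
Proof. by case: b; rewrite /pm ?opprK. Qed.

Lemma pm_sqr (R : realType) (b : bool) : pm R b * pm R b = 1.
Proof. by case: b; rewrite /pm ?mulr1 ?mulrNN ?mulr1. Qed.

Lemma card_cube_gt0 (I : finType) : (0 < #|cube I|)%N.
Proof. by rewrite card_ffun card_bool expn_gt0. Qed.

Lemma influence_half (R : realType) (I : finType) (f : boolfun I) (i : I) :
  influence R f [set i] = 1 / 2 <-> (#|sens f i| * 2 = #|cube I|)%N.
Proof.
have N0 : #|cube I|%:R != 0 :> R by rewrite pnatr_eq0 -lt0n card_cube_gt0.
rewrite /influence -/(sens f i); split => [/eqP|h].
  rewrite eqr_div // ?mul1r; last by rewrite pnatr_eq0.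
  by rewrite -natrM eqr_nat => /eqP.
move: N0; rewrite -h natrM mulf_eq0 negb_or => /andP[h1 h2].
by field; rewrite h1.
Qed.

Lemma sum_mem (R : realType) (T : finType) (A : {set T}) :
  \sum_x (x \in A)%:R = #|A|%:R :> R.
Proof.
rewrite -sum1_card natr_sum [RHS]big_mkcond.
by apply: eq_bigr => x _; case: (x \in A).
Qed.

Lemma sum_pm_sens (R : realType) (I : finType) (f : boolfun I) (i : I) :
  \sum_(x : cube I) pm R (f x) * pm R (f (flip x [set i])) =
  #|cube I|%:R - 2 * #|sens f i|%:R.
Proof.
rewrite (eq_bigr (fun x => 1 - 2 * (x \in sens f i)%:R)) => [|x _].
  by rewrite sumrB sumr_const -big_distrr /= sum_mem.
by rewrite inE /pm; case: (f x); case: (f _) => /=; lra.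
Qed.

(** Expansion of the product of the 1 + x_i y_i, where a factor vanishes as soon as [x] and [y]
    differ. *)
Lemma sum_characters (R : realType) (n : nat) (x y : cube 'I_n) :
  \sum_(S : {set 'I_n}) (\prod_(i in S) pm R (x i)) * \prod_(i in S) pm R (y i) =
  if x == y then 2 ^+ n else 0.
Proof.
transitivity (\prod_(i < n) (pm R (x i) * pm R (y i) + 1)).
  rewrite bigA_distr; apply: eq_bigr => S _.
  by rewrite -big_split -big_mkcond.
case: eqP => [->|/eqP xy].
  under eq_bigr do rewrite pm_sqr.
  by rewrite prodr_const card_ord.
have /existsP[i xi] : [exists i, x i != y i].
  rewrite -negb_forall; apply: contra xy => /forallP h.
  by apply/eqP/ffunP => i; apply/eqP.
rewrite (bigD1 i) //=.
have -> : pm R (x i) = - pm R (y i).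
  by rewrite -pm_neg; move: xi; case: (x i); case: (y i).
by rewrite mulNr pm_sqr addNr mul0r.
Qed.

(** The autocorrelation of [f] is the transform of its squared coefficients. These are all equal, so
    it vanishes in direction [i] by orthogonality of characters. *)
Lemma bent_SAC (R : realType) (n : nat) (f : boolfun 'I_n) :
  bent R f -> SAC R f.
Proof.
move=> [_ hf] i; apply/influence_half.
pose chi (S : {set 'I_n}) (x : cube 'I_n) : R := \prod_(k in S) pm R (x k).
pose u : cube 'I_n := [ffun=> true].
have chi_flip S x : chi S (flip x [set i]) = chi S x * chi S (flip u [set i]).
  rewrite /chi -big_split; apply: eq_bigr => k _ /=; rewrite !ffunE inE.
  by case: ifP => _; rewrite /pm; case: (x k); rewrite ?mulr1 ?mul1r ?mulrNN ?mulr1.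
have flip_neq x : (x == flip x [set i]) = false.
  apply/negbTE/negP => /eqP/ffunP/(_ i); rewrite ffunE inE eqxx.
  by case: (x i).
pose g S : R := \sum_(x : cube 'I_n) pm R (f x) * chi S x.
have g2 S : g S ^+ 2 = (2 ^+ n * (2 ^+ n./2)^-1) ^+ 2.
  have n0 : 2 ^+ n != 0 :> R by rewrite expf_neq0 // pnatr_eq0.
  have -> : g S = 2 ^+ n * fourier R f S by rewrite /fourier mulVKf.
  by case: (hf S) => ->; rewrite ?mulrN ?sqrrN.
have T0 : \sum_(S : {set 'I_n}) g S ^+ 2 * chi S (flip u [set i]) = 0.
  under eq_bigr do rewrite g2.
  rewrite -big_distrr /=.
  have := sum_characters R u (flip u [set i]).
  rewrite flip_neq => h; rewrite (eq_bigr (fun S => chi S u * chi S (flip u [set i]))).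
    by rewrite h mulr0.
  by move=> S _; rewrite [chi S u]big1 ?mul1r // => k _; rewrite ffunE.
have T1 : \sum_(S : {set 'I_n}) g S ^+ 2 * chi S (flip u [set i]) =
    2 ^+ n * \sum_(x : cube 'I_n) pm R (f x) * pm R (f (flip x [set i])).
  under eq_bigr => S _.
    rewrite expr2 -mulrA /g big_distrl big_distrl /=.
    under eq_bigr => x _.
      rewrite big_distrr /=; under eq_bigr => y _.
        rewrite (_ : _ * _ =
            (pm R (f x) * pm R (f y)) * (chi S x * chi S (flip y [set i])));
          last by rewrite (chi_flip S y); ring.
        over.
      over.
    over.
  rewrite exchange_big /= big_distrr; apply: eq_bigr => x _ /=.
  rewrite exchange_big /= (bigD1 (flip x [set i])) //= -big_distrr /=.
  rewrite flipK sum_characters eqxx big1 ?addr0; first by rewrite mulrC.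
  move=> y yx; rewrite -big_distrr /= sum_characters.
  by case: eqP => [e|_]; [move: yx; rewrite e flipK eqxx | rewrite mulr0].
have := T1; rewrite T0 sum_pm_sens => /esym/eqP.
rewrite mulf_eq0 expf_eq0 pnatr_eq0 andbF /= subr_eq0 -natrM eqr_nat.
by move/eqP->; rewrite mulnC.
Qed.

Lemma SACk_SAC (R : realType) (n k : nat) (f : boolfun 'I_n) :
  (k + 2 <= n)%N -> SACk R k f -> SAC R f.
Proof.
move=> kn hf i; apply/influence_half.
have [J Jk iJ] : exists2 J : {set 'I_n}, #|J| = k & i \notin J.
  have : (k <= #|~: [set i]|)%N by rewrite cardsC1 card_ord; lia.
  case/card_geqP => s [us ss sS]; exists [set j in s].
    by rewrite cardsE (card_uniqP us).
  by apply/negP; rewrite inE => /sS; rewrite !inE eqxx.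
set sub := cube {j | j \notin J}.
pose glue (y : sub) (z : cube 'I_n) : cube 'I_n :=
  [ffun j => if insub j is Some j' then y j' else z j].
pose i' : {j | j \notin J} := exist _ i iJ.
have glue_flip y z : glue (flip y [set i']) z = flip (glue y z) [set i].
  apply/ffunP => j; rewrite !ffunE inE.
  case: insubP => [j' jJ <-|jJ]; first by rewrite ffunE inE -(inj_eq val_inj).
  by case: eqP => // e; rewrite e iJ in jJ.
(* The values of [z] outside [J], which [glue] ignores, are exchanged with [y]: this turns
   [glue y z] into a uniform point of the full cube. *)
pose swap (p : cube 'I_n * sub) : cube 'I_n * sub :=
  (glue p.2 p.1, [ffun j => p.1 (val j)]).
have swapK : involutive swap.
  case=> z y; congr (_, _); apply/ffunP => j; rewrite !ffunE /=.
    by case: insubP => [j' _ <-|_] //; rewrite ffunE.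
  by rewrite (valK j).
apply/eqP; rewrite -(eqn_pmul2r (card_cube_gt0 {j | j \notin J})) mulnAC.
rewrite -(cardsT sub) -cardsX -(card_preimset _ (inv_inj swapK)) card_pairs.
rewrite big_distrl /= cardsT -sum_nat_const; apply/eqP/eq_bigr => z _.
have /(_ i')/influence_half <- := hf J z Jk; congr (_ * _)%N.
apply: eq_card => y; rewrite !inE /= andbT.
by rewrite -glue_flip.
Qed.

Lemma inX_SAC (R : realType) (n : nat) (f : boolfun 'I_n) : inX R f -> SAC R f.
Proof.
case=> [|[k [kn]]|[k [/andP[k1 _] hf]] i]; first exact: bent_SAC.
  exact: SACk_SAC.
by apply: hf; rewrite cards1.
Qed.

(** * Unate functions: monotone and threshold functions *)

Definition unate (I : finType) (s : cube I) (f : boolfun I) : Prop :=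
  forall (x : cube I) (i : I), x i = s i -> f (flip x [set i]) -> f x.

(* The correlation of [f] with [s_i x_i] is [Inf_i f = 1/2], so the mean square of
   [f - 1/2 \sum_i s_i x_i] is [1 - n/4]; it is positive because at [x = s] the
   linear form takes the value [n/2 > 1]. *)
Lemma unate_not_SAC (R : realType) (n : nat) (s : cube 'I_n) (f : boolfun 'I_n) :
  (4 <= n)%N -> unate s f -> ~ SAC R f.
Proof.
move=> n4 uf hf.
pose a i (x : cube 'I_n) : R := pm R (s i) * pm R (x i).
have a_flip i x : a i (flip x [set i]) = - a i x.
  by rewrite /a ffunE inE eqxx pm_neg mulrN.
have flip_inj (i : 'I_n) : injective (fun x : cube 'I_n => flip x [set i]).
  exact: inv_inj (flipK _).
set N : R := #|cube 'I_n|%:R.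
have fa i : \sum_(x : cube 'I_n) pm R (f x) * a i x = N / 2.
  have /influence_half h := hf i.
  rewrite /N -h natrM mulfK ?pnatr_eq0 // -sum_mem.
  (* Pairing [x] with its flip gives terms [(f x - f (flip x [set i])) * a i x] in values of [pm];
     unateness makes them 2 at sensitive points. *)
  set T := LHS; suff : T + T = 2 * \sum_x (x \in sens f i)%:R by lra.
  rewrite {2}/T (reindex_inj (flip_inj i)) -big_split big_distrr /=.
  apply: eq_bigr => x _; rewrite a_flip inE /a.
  have := uf x i; have := uf (flip x [set i]) i.
  rewrite flipK ffunE inE eqxx /pm.
  case: (x i) (s i) => [] []; case: (f x); case: (f _) => /= h1 h2;
    rewrite ?mulr1 ?mul1r ?mulrN ?mulrNN; try lra;
    by [have := h1 erefl erefl | have := h2 erefl erefl].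
have aa i j : \sum_(x : cube 'I_n) a i x * a j x = if i == j then N else 0.
  case: eqP => [<-|/eqP ij].
    under eq_bigr do rewrite /a mulrACA !pm_sqr mulr1.
    by rewrite sumr_const.
  set T := LHS; suff : T = - T by lra.
  rewrite {1}/T (reindex_inj (flip_inj i)) -sumrN; apply: eq_bigr => x _.
  rewrite a_flip mulNr; congr (- (_ * _)).
  by rewrite /a ffunE inE eq_sym (negbTE ij).
pose L x : R := \sum_(i < n) a i x.
have : \sum_(x : cube 'I_n) (pm R (f x) - L x / 2) ^+ 2 = N * (1 - n%:R / 4).
  transitivity (\sum_(x : cube 'I_n) (1 - \sum_i pm R (f x) * a i x
      + (\sum_i \sum_j a i x * a j x) / 4)).
    apply: eq_bigr => x _; rewrite -big_distrr /= -/(L x).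
    have -> : \sum_i \sum_j a i x * a j x = L x * L x.
      by rewrite [RHS]big_distrl; apply: eq_bigr => i _; rewrite -big_distrr.
    by rewrite -[X in _ = X - _ + _](pm_sqr R (f x)); field.
  rewrite big_split sumrB /= sumr_const -/N -big_distrl /=.
  rewrite exchange_big (eq_bigr (fun=> N / 2)) // [X in _ + X / _]exchange_big /=.
  rewrite [X in _ + X / _](eq_bigr (fun=> N)); last first.
    move=> i _; rewrite exchange_big (eq_bigr _ (fun j _ => aa i j)) -big_mkcond.
    by rewrite (big_pred1 i) // => j; rewrite eq_sym.
  by rewrite !sumr_const card_ord -[N / 2 *+ n]mulr_natr -[N *+ n]mulr_natr; field.
have n4' : 4 <= n%:R :> R by rewrite (ler_nat R 4).
have Ls : L s = n%:R.
  rewrite /L (eq_bigr (fun=> 1)); first by rewrite sumr_const card_ord.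
  by move=> i _; rewrite /a pm_sqr.
have N0 : 0 < N by rewrite ltr0n card_cube_gt0.
rewrite (bigD1 s) //= Ls.
set X := \sum_(_ | _) _; have X0 : 0 <= X by apply: sumr_ge0 => x _; apply: sqr_ge0.
have : 0 < (pm R (f s) - n%:R / 2) ^+ 2.
  by rewrite lt0r sqr_ge0 andbT sqrf_eq0 /pm; apply/eqP; case: (f s); lra.
by nra.
Qed.

Lemma monotone_unate (n : nat) (f : boolfun 'I_n) :
  monotone f -> unate [ffun=> true] f.
Proof.
move=> mf x i; rewrite ffunE => xi.
suff : (f (flip x [set i]) <= f x)%O by rewrite leEbool; case: (f _); case: (f x).
by apply: mf => j; rewrite ffunE inE; case: eqP => // ->; rewrite xi.
Qed.

(** Each variable is oriented by the sign of its weight, so moving it to [s i] never lowers the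
    linear form. *)
Lemma LTF_unate (R : realType) (n : nat) (f : boolfun 'I_n) :
  LTF R f -> exists s, unate s f.
Proof.
move=> [w0 [w hf]]; exists [ffun i => 0 <= w i] => x i; rewrite ffunE => xi.
have pos y : f y = (0 < w0 + \sum_(i < n) w i * pm R (y i)).
  have := hf y; rewrite /sign /pm; case: (f y); case: ifP => // _ h; exfalso; lra.
rewrite !pos => /lt_le_trans; apply; rewrite lerD2l.
apply: ler_sum => j _; rewrite ffunE inE; case: eqP => // ->.
rewrite xi; case: (lerP 0 (w i)); rewrite /pm /=; lra.
Qed.

(** * Constant-depth circuits of polynomial size against SAC *)

(** For n >= 1, p(n) is at most [A] n^(size p), and one more power of n absorbs [A]. *)
Lemma horner_le_expn (R : realType) (p : {poly R}) :
  exists k n0 : nat, forall n, (n0 <= n)%N -> p.[n%:R] <= (n ^ k)%:R.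
Proof.
pose A := \sum_(i < size p) `|p`_i|.
have A0 : 0 <= A by apply: sumr_ge0.
exists (size p).+1, (Num.bound A).+1 => n hn.
have n1 : 1 <= n%:R :> R by rewrite ler1n; lia.
apply: (@le_trans _ _ (A * n%:R ^+ size p)).
  rewrite horner_coef big_distrl; apply: ler_sum => i _ /=.
  apply: le_trans (ler_norm _) _; rewrite normrM ler_wpM2l //.
  by rewrite ger0_norm ?exprn_ge0 // ler_weXn2l // ltnW.
rewrite natrX exprS ler_wpM2r ?exprn_ge0 //.
apply: ltW (lt_le_trans (archi_boundP A0) _).
by rewrite ler_nat ltnW.
Qed.

Lemma SAC_total_sens (R : realType) (n : nat) (f : boolfun 'I_n) :
  SAC R f -> (total_sens f * 2 = n * #|cube 'I_n|)%N.
Proof.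
move=> hf; rewrite /total_sens big_distrl /=.
rewrite (eq_bigr (fun=> #|cube 'I_n|)) ?sum_nat_const ?card_ord // => i _.
exact/influence_half/hf.
Qed.

Lemma AC0_not_SAC (R : realType) (p : {poly R}) (d : nat) :
  (0 < d)%N -> exists n0 : nat, (0 < n0)%N /\
    forall n : nat, (n0 <= n)%N ->
      forall f : boolfun 'I_n, AC0 p d f -> ~ SAC R f.
Proof.
move=> d0; have [k [n1 hp]] := horner_le_expn p.
(* Below, n <= (2^m)^(4d), so both n and n^k are at most (2^m)^K. *)
pose K := (4 * d * k.+1)%N.
have [C hC] := layered_total_sens d 1 K.
(* The second bound forces [m] to exceed [2 * C]. *)
exists (maxn n1 (2 ^ (2 * d * (2 * C + 1))))%N; split.
  by rewrite leq_max expn_gt0 orbT.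
move=> n; rewrite geq_max => /andP[nn1 nC] f [k' [c [is_and [out [cs hf]]]]] sf.
have cs' : (num_gates c <= n ^ k)%N by rewrite -(ler_nat R) (le_trans cs) ?hp.
pose e := trunc_log 2 n.
have n0 : (0 < n)%N by apply: leq_trans nC; rewrite expn_gt0.
have /andP[e1 e2] : (2 ^ e <= n < 2 ^ e.+1)%N by apply: trunc_log_bounds.
have eC : (2 * d * (2 * C + 1) <= e)%N by apply: trunc_log_max.
(* The largest [m] with (2^m)^(2d) <= 2^e, hence (2^m)^d is at most the square root of n. *)
pose m := (e %/ (2 * d))%N.
have d20 : (0 < 2 * d)%N by rewrite muln_gt0.
have mC : (2 * C + 1 <= m)%N by rewrite leq_divRL // mulnC.
have m1 : (m * (2 * d) <= e)%N by apply: leq_trunc_div.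
have m2 : (e.+1 <= m * (4 * d))%N.
  have := ltn_ceil e d20; rewrite -/m; nia.
have nM : (n <= (2 ^ m) ^ (4 * d))%N.
  by rewrite -expnM (leq_trans (ltnW e2)) // leq_exp2l.
have M0 : (0 < 2 ^ m)%N by rewrite expn_gt0.
have hI : (#|'I_n| <= (2 ^ m) ^ K)%N.
  rewrite card_ord (leq_trans nM) // leq_pexp2l // /K; nia.
have hs : (n ^ k <= (2 ^ m) ^ K)%N.
  apply: (@leq_trans (((2 ^ m) ^ (4 * d)) ^ k)%N).
    by case: (k) => [|k0]; rewrite ?expn0 ?leq_exp2r.
  by rewrite -expnM leq_pexp2l // /K leq_mul2l leqnSn orbT.
have := hC m 'I_n _ _ _ out _ hI hs (layered_circuit is_and cs').
have -> : total_sens (fun x => node_value is_and c x out) = total_sens f.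
  by apply: eq_bigr => i _; apply: eq_card => x; rewrite !inE !hf.
move=> /(_ _)/(leq_mul (leqnn 2)); rewrite mulnC (SAC_total_sens sf) mulnA.
rewrite leq_pmul2r ?card_cube_gt0 // => h.
have {}h : (n <= 2 * (C * (2 ^ m) ^ d))%N by apply: h; lia.
have h1 : ((2 ^ m) ^ d * (2 ^ m) ^ d <= n)%N.
  by rewrite -expnD -expnM addnn -mul2n (leq_trans _ e1) // leq_exp2l.
have h2 : (m < (2 ^ m) ^ d)%N.
  apply: leq_trans (ltn_expl m (isT : 1 < 2)%N) _.
  by rewrite -{1}[(2 ^ m)%N]expn1 leq_pexp2l.
(* Cancelling (2^m)^d leaves (2^m)^d <= 2C, against 2C < m < (2^m)^d. *)
have : ((2 ^ m) ^ d * (2 ^ m) ^ d <= 2 * C * (2 ^ m) ^ d)%N.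
  by rewrite -mulnA (leq_trans h1).
by rewrite leq_pmul2r ?(leq_ltn_trans _ h2) //; lia.
Qed.

Theorem theorem1 (R : realType) :
  [/\ forall n : nat, (4 <= n)%N ->
        forall f : boolfun 'I_n, monotone f -> ~ inX R f,
      forall n : nat, (16 <= n)%N ->
        forall f : boolfun 'I_n, LTF R f -> ~ inX R f
    & forall (p : {poly R}) (d : nat), (0 < d)%N ->
        exists n0 : nat, (0 < n0)%N /\
          forall n : nat, (n0 <= n)%N ->
            forall f : boolfun 'I_n, AC0 p d f -> ~ inX R f].
Proof.
split.
- move=> n n4 f /monotone_unate uf /inX_SAC; exact: unate_not_SAC uf.
- move=> n n16 f /LTF_unate[s uf] /inX_SAC; apply: unate_not_SAC uf.
  exact: leq_trans n16.
- move=> p d d0; have [n0 [n00 h]] := AC0_not_SAC p d0.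
  by exists n0; split=> // n hn f hf /inX_SAC; apply: h hf.
Qed.
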